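(* Let $(\Omega,\mathcal F)$ be a measurable space and let $\mathcal P\subseteq\mathcal M_1$ be an arbitrary nonempty set of probability measures. For any $\mathsf Q\in\mathcal M_1$, $$\min_{\mathsf P\in\mathcal P_{\mathrm{eff}}}H(\mathsf Q\mid\mathsf P)=\min_{\mu\in\overline{\mathrm{co}}^*(\mathcal P)}H(\mathsf Q\mid\mu).$$
   Context: $\mathcal M_+$ and $\mathcal M_1$ are the sets of finite nonnegative (countably additive) measures and probability measures on $\mathcal F$. An e-variable for $\mathcal P$ is a measurable $X:\Omega\to[0,\infty]$ with $\int X\,d\mathsf P\le1$ for all $\mathsf P\in\mathcal P$; $\mathcal E$ is the set of all e-variables. The effective null is $\mathcal P_{\mathrm{eff}}=\{\mathsf P\in\mathcal M_+:\int X\,d\mathsf P\le1\text{ for all }X\in\mathcal E\}$. $\mathcal B_b$ is the Banach space of bounded measurable functions $\Omega\to\mathbb R$ with the supremum norm. $\mathrm{ba}$ is the space of bounded finitely additive signed measures on $(\Omega,\mathcal F)$, $\mathrm{ba}_+$ its positive cone, and $\mathrm{ba}_1=\{\mu\in\mathrm{ba}_+:\mu(\Omega)=1\}$. $\overline{\mathrm{co}}^*(\mathcal P)$ is the closure of the convex hull of $\mathcal P$ in $\mathrm{ba}$ for the weak-$*$ topology $\sigma(\mathrm{ba},\mathcal B_b)$. Relative entropy: for $\nu\in\mathrm{ba}_1$, $\mu\in\mathrm{ba}_+$ and a finite measurable partition $\pi=\{A_1,\dots,A_n\}$ of $\Omega$, $H_\pi(\nu\mid\mu)=\sum_{i=1}^n\nu(A_i)\log\frac{\nu(A_i)}{\mu(A_i)}$,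 where $q\log(q/p)=0$ if $q=0$ and $=\infty$ if $p=0<q$; $H(\nu\mid\mu)=\sup_\pi H_\pi(\nu\mid\mu)$ over all finite measurable partitions. For $\nu\in\mathcal M_1$ and $\mu\in\mathcal M_+$ this is the usual Kullback–Leibler divergence. *)

(* Defs.v *)
From HB Require Import structures.
From mathcomp Require Import all_boot all_order all_algebra.
From mathcomp Require Import all_classical all_reals all_analysis.
From mathcomp Require Import measurable_realfun.

Set Implicit Arguments.
Unset Strict Implicit.
Unset Printing Implicit Defensive.

Import Order.TTheory GRing.Theory Num.Theory.
Import numFieldNormedType.Exports.

Local Open Scope classical_set_scope.
Local Open Scope ring_scope.

Section effective_null.
Context (d : measure_display) (T : measurableType d) (R : realType).
Implicit Types P : set (probability T R).
Local Open Scope ereal_scope.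

Definition evariable P : set (T -> \bar R) :=
  [set X : T -> \bar R | [/\ measurable_fun [set: T] X, forall x, 0 <= X x &
               forall p, P p -> \int[p]_x X x <= 1]].

Definition effective_null P : set {finite_measure set T -> \bar R} :=
  [set p | forall X, evariable P X -> \int[p]_x X x <= 1].

End effective_null.

Section ba_space.
Context (d : measure_display) (T : measurableType d) (R : realType).

(* Set functions are total on [set T]; the last clause makes two elements that
   agree on the sigma-algebra equal. *)
Definition ba_pred : {pred set T -> R} := mem [set mu : set T -> R | [/\
  forall A B, measurable A -> measurable B -> A `&` B = set0 ->
    mu (A `|` B) = mu A + mu B,
  exists M, forall A, measurable A -> `|mu A| <= M &
  forall A, ~ measurable A -> mu A = 0]].

Lemma ba_submod_closed : submod_closed ba_pred.
Proof.
split; first by apply: mem_set; split=> [*||]; rewrite ?addr0//;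
  exists 0 => A _; rewrite normr0.
move=> a f g /set_mem[fD [M fM] f0] /set_mem[gD [N gN] g0]; apply: mem_set.
split.
- by move=> A B mA mB AB; rewrite /= !fctE fD// gD// scalerDr addrACA.
- exists (`|a| * M + N) => A mA; rewrite !fctE (le_trans (ler_normD _ _))//.
  by rewrite lerD ?gN// normrM ler_wpM2l ?fM.
- by move=> A nA; rewrite !fctE f0// g0// scaler0 addr0.
Qed.

HB.instance Definition _ :=
  GRing.isSubmodClosed.Build R (set T -> R) ba_pred ba_submod_closed.

Record ba : Type := BA { ba_fun :> set T -> R ; ba_funP : ba_fun \in ba_pred }.

HB.instance Definition _ := [isSub for ba_fun].
HB.instance Definition _ := [Choice of ba by <:].
HB.instance Definition _ := [SubChoice_isSubLmodule of ba by <:].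

Lemma ba_of_measure_subproof (P : {finite_measure set T -> \bar R}) :
  (fun A => if A \in measurable then fine (P A) else 0) \in ba_pred.
Proof.
have fP A : measurable A -> P A \is a fin_num by exact: fin_num_measure.
apply: mem_set; split.
- move=> A B mA mB AB; rewrite !mem_set//; last exact: measurableU.
  by rewrite measureU// fineD// fP.
- exists (fine (P [set: T])) => A mA; rewrite mem_set//.
  rewrite ger0_norm ?fine_ge0// fine_le ?fP//.
  by rewrite le_measure ?inE.
- by move=> A nA; rewrite memNset.
Qed.

Definition ba_of_measure (P : {finite_measure set T -> \bar R}) : ba :=
  BA (ba_of_measure_subproof P).

(* Integral of a simple function [s]; the sum over [R] has finite support. *)
Definition ba_sintegral (mu : ba) (s : T -> R) : R :=
  \sum_(x \in [set: R]) x * mu (s @^-1` [set x]).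

(* Continuous extension of the integral from simple functions to their uniform
   limits. *)
Definition ba_integral (mu : ba) (f : T -> R) : R :=
  lim (ba_sintegral mu s @[s --> within
    [set s : T -> R | measurable_fun [set: T] s /\ finite_set (range s)]
    (nbhs (f : {uniform T -> R}))]).

Definition bounded_mfun : set {mfun T >-> R} := [set f | bounded_fun f].

Definition ba_pairing (mu : ba) : {ptws bounded_mfun -> R} :=
  fun f => ba_integral mu (val f).

(* The topology of [ba] is the weak-* topology sigma(ba, B_b). *)
HB.instance Definition _ :=
  Topological.copy ba (initial_topology ba_pairing).

Local Open Scope ereal_scope.

Definition entropy_term (q p : R) : \bar R :=
  if q == 0%R then 0 else if p == 0%R then +oo else (q * ln (q / p))%:E.

(* Meaningful for nonnegative [mu] and [nu] with [nu setT = 1]. *)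
Definition relative_entropy (nu mu : ba) : \bar R :=
  ereal_sup [set h | exists n (A : 'I_n -> set T),
    [/\ forall i, measurable (A i), partition [set: 'I_n] A [set: T] &
        h = \sum_(i < n) entropy_term (nu (A i)) (mu (A i))]].

End ba_space.

Definition convex_hull (R : numDomainType) (E : lmodType R) (A : set E) :
  set E := smallest (@convex_set R E) A.

Definition is_minimum (R : realType) (A : set (\bar R)) (m : \bar R) : Prop :=
  A m /\ lbound A m.

(* Main.v *)
Require Import Defs.
From HB Require Import structures.
From mathcomp Require Import all_boot all_order all_algebra.
From mathcomp Require Import all_classical all_reals all_analysis.
From mathcomp Require Import measurable_realfun.
From mathcomp Require Import unstable finmap zify ring lra.
Set Implicit Arguments.
Unset Strict Implicit.
Unset Printing Implicit Defensive.
Import Order.TTheory GRing.Theory Num.Theory.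
Import numFieldNormedType.Exports.
Import HBNNSimple.
Local Open Scope classical_set_scope.
Local Open Scope ring_scope.
Local Open Scope convex_scope.

(** Write [C] for the weak-* closed convex hull of [P] and [H mu] for the
    entropy of [Q] relative to [mu].  Both minima agree because each element of
    one set is matched, without increasing the entropy, by an element of the
    other, and because the minimum over [C] is attained.

    From the effective null to [C].  Every [p] in the effective null lies below
    some [mu] in [C] (lemma [effective_null_dominated]), and [H] is decreasing.
    On finitely many events [A_i], minimise the sum of the squared positive
    parts of [p A_i - k A_i] over the convex hull: if the infimum were positive,
    the positive parts at a near-minimiser would be nonnegative weights [w_i]
    such that [\sum_i w_i 1_(A_i)] is, up to a scalar, an e-variable whose
    [p]-integral exceeds 1 (lemma [dominate_or_separate]).  This direct
    argument replaces a separation theorem.  Compactness of [C] passes from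
    finitely many events to all of them.

    From [C] to the effective null.  The outer measure generated by [mu] through
    countable measurable covers restricts to a countably additive measure
    [sigma_part] below [mu], the countably additive part of the Yosida-Hewitt
    decomposition.  Since it lies below [mu], it integrates every simple
    function below an e-variable to at most 1, hence it is in the effective
    null.  Its entropy is not larger than [H mu] (lemma [sigma_part_entropy]):
    as [Q] is countably additive, every event [B] contains an event [E] that
    exhausts it up to small [Q]-probability and on which [mu] is almost as small
    as [sigma_part] on [B]; the part of the space left over contributes almost
    nothing to the entropy.

    Attainment.  [C] is weak-* compact, because a limit along an ultrafilter of
    finitely additive probabilities is one, and [H] is lower semicontinuous.

    All estimates on the entropy go through one duality formula (lemma
    [relative_entropy_leP]): [q * ln (q / p)] is the supremum over real [t] of
    [q * (t + 1) - p * expR t], so that [H] is a supremum of functions that are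
    affine in the values of [mu] and [Q].  Monotonicity, lower semicontinuity
    and the passage to the countably additive part then become statements about
    affine functions, without case distinctions on vanishing masses. *)

(** * Finitely additive set functions and simple integrals *)

Section finitely_additive.
Context (d : measure_display) (T : measurableType d) (R : realType).
Implicit Types (mu : ba T R) (A B : set T).

Lemma baU mu A B : measurable A -> measurable B -> A `&` B = set0 ->
  mu (A `|` B) = mu A + mu B.
Proof. by have /set_mem[+ _ _] := ba_funP mu; exact. Qed.

Lemma ba_nonmeasurable mu A : ~ measurable A -> mu A = 0.
Proof. by have /set_mem[_ _] := ba_funP mu; exact. Qed.

Lemma ba_bounded mu : exists2 M, 0 <= M & forall A, `|mu A| <= M.
Proof.
have /set_mem[_ [M MP] _] := ba_funP mu; exists M => [|A].
  by rewrite (le_trans _ (MP set0 measurable0)).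
have [/MP//|mA] := pselect (measurable A).
by rewrite ba_nonmeasurable// normr0 (le_trans _ (MP set0 measurable0)).
Qed.

Lemma ba0 mu : mu set0 = 0.
Proof.
apply/(addrI (mu set0)); rewrite addr0 -baU ?setU0//; exact: setI0.
Qed.

Lemma ba_bigU mu (I : choiceType) (s : seq I) (p : pred I) (F : I -> set T) :
  uniq s -> (forall i, measurable (F i)) -> trivIset setT F ->
  mu (\big[setU/set0]_(i <- s | p i) F i) = \sum_(i <- s | p i) mu (F i).
Proof.
move=> + mF tF; elim: s => [|i s IH] /=; first by rewrite !big_nil ba0.
case/andP => si us; rewrite !big_cons; case: ifP => // pi; last exact: IH.
rewrite baU ?IH//; first by apply: bigsetU_measurable.
rewrite big_distrr/= big_seq_cond big1// => j /andP[js _].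
have [//|/set0P/tF ij] := eqVneq (F i `&` F j) set0.
by move: si; rewrite ij// js.
Qed.

(** A bounded charge has bounded variation: the blocks of nonnegative mass and
    the blocks of negative mass each have a union of mass at most [M]. *)
Lemma ba_variation_le mu M (I : choiceType) (s : seq I) (F : I -> set T) :
  (forall A, measurable A -> `|mu A| <= M) ->
  uniq s -> (forall i, measurable (F i)) -> trivIset setT F ->
  \sum_(i <- s) `|mu (F i)| <= M *+ 2.
Proof.
move=> hM us mF tF.
rewrite (bigID (fun i => 0 <= mu (F i)))/= mulr2n; apply: lerD.
  rewrite (eq_bigr (fun i => mu (F i))); last by move=> i; exact: ger0_norm.
  rewrite -ba_bigU//; apply: le_trans (hM _ _); first exact: ler_norm.
  exact: bigsetU_measurable.
rewrite (eq_bigr (fun i => - mu (F i))); last first.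
  by move=> i; rewrite -ltNge; exact: ltr0_norm.
rewrite sumrN -ba_bigU//.
apply: le_trans (hM (\big[setU/set0]_(i <- s | ~~ (0 <= mu (F i))) F i) _).
  by rewrite -normrN ler_norm.
exact: bigsetU_measurable.
Qed.

Lemma preimage_bigU (V : choiceType) (r : T -> V) (p : pred V) :
  finite_set (range r) ->
  r @^-1` [set x | p x] =
  \big[setU/set0]_(z <- fset_set (range r) | p z) r @^-1` [set z].
Proof.
move=> fr; rewrite -bigcup_seq_cond; apply/seteqP; split => x /=.
  by move=> px; exists (r x) => //=; rewrite in_fset_set// mem_set.
by case=> z /andP[_ pz] ->.
Qed.

Lemma ba_preimage mu (V : choiceType) (r : T -> V) (p : pred V) :
  finite_set (range r) -> (forall z, measurable (r @^-1` [set z])) ->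
  mu (r @^-1` [set x | p x]) =
  \sum_(z <- fset_set (range r) | p z) mu (r @^-1` [set z]).
Proof.
move=> fr mr; rewrite preimage_bigU// ba_bigU ?fset_uniq//.
by move=> i j _ _ [x [/= -> ->]].
Qed.

(** Computing the integral along the fibres of an arbitrary finite-range [r],
    rather than those of the integrand, allows two simple functions to be
    integrated over a common refinement. *)
Lemma ba_sintegral_comp mu (V : choiceType) (r : T -> V) (g : V -> R) :
  finite_set (range r) -> (forall z, measurable (r @^-1` [set z])) ->
  ba_sintegral mu (g \o r) =
  \sum_(z <- fset_set (range r)) g z * mu (r @^-1` [set z]).
Proof.
move=> fr mr; have fgr : finite_set (range (g \o r)).
  by rewrite -(image_comp r g); exact: finite_image.
transitivity (\sum_(x <- fset_set (range (g \o r)))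
    x * mu ((g \o r) @^-1` [set x])).
  rewrite /ba_sintegral -fsbig_finite//; apply/esym/fsbig_widen => // x [_ nx]/=.
  rewrite (_ : _ @^-1` _ = set0) ?ba0 ?mulr0//.
  by apply/seteqP; split => // t /= gt; apply: nx; exists t.
transitivity (\sum_(x <- fset_set (range (g \o r)))
    \sum_(z <- fset_set (range r) | g z == x) g z * mu (r @^-1` [set z])).
  apply: eq_bigr => x _.
  rewrite (_ : _ @^-1` _ = r @^-1` [set z | g z == x]); last first.
    by apply/seteqP; split => t /= /eqP.
  by rewrite ba_preimage// mulr_sumr; apply: eq_bigr => z /eqP ->.
rewrite (exchange_big_dep xpredT)//= big_seq [RHS]big_seq.
apply: eq_bigr => z; rewrite in_fset_set// => /set_mem[t _ <-].
rewrite big_mkcond (bigD1_seq (g (r t)))//= ?fset_uniq ?eqxx//; last first.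
  by rewrite in_fset_set// mem_set//; exists t.
by rewrite big1 ?addr0// => y; rewrite eq_sym; case: eqP.
Qed.

Definition simple_mfun : set (T -> R) :=
  [set s | measurable_fun setT s /\ finite_set (range s)].

Lemma simple_preimage s z : simple_mfun s -> measurable (s @^-1` [set z]).
Proof. by move=> [ms _]; rewrite -[X in measurable X]setTI; exact: ms. Qed.

(** Both integrals are taken over the common refinement [x |-> (s x, t x)], whose
    variation is bounded; this is what makes the uniform extension of the
    integral meaningful. *)
Lemma ba_sintegral_lip mu M s t (e : R) :
  (forall A, measurable A -> `|mu A| <= M) ->
  simple_mfun s -> simple_mfun t -> (forall x, `|s x - t x| <= e) ->
  `|ba_sintegral mu s - ba_sintegral mu t| <= e * (M *+ 2).
Proof.
move=> hM ss st ste; pose r x := (s x, t x).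
have fr : finite_set (range r).
  apply: (@sub_finite_set _ _ (range s `*` range t)); last first.
    by apply: finite_setX; [case: ss|case: st].
  by move=> _ [x _ <-] /=; split; exists x.
have mr z : measurable (r @^-1` [set z]).
  rewrite (_ : _ @^-1` _ = s @^-1` [set z.1] `&` t @^-1` [set z.2]).
    by apply: measurableI; exact: simple_preimage.
  by apply/seteqP; split => x; rewrite /r/=; case: z => a b/= [-> ->].
rewrite (ba_sintegral_comp mu fst fr mr : ba_sintegral mu s = _).
rewrite (ba_sintegral_comp mu snd fr mr : ba_sintegral mu t = _).
rewrite -sumrB; apply: le_trans (ler_norm_sum _ _ _) _.
have e0 : 0 <= e by rewrite (le_trans _ (ste point)).
apply: (@le_trans _ _ (e * \sum_(z <- fset_set (range r))
    `|mu (r @^-1` [set z])|)).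
  rewrite mulr_sumr big_seq [leRHS]big_seq; apply: ler_sum => z.
  rewrite in_fset_set// => /set_mem[x _ <-].
  by rewrite -mulrBl normrM; exact: ler_wpM2r (normr_ge0 _) _ _ (ste x).
apply: ler_wpM2l => //; apply: ba_variation_le => //.
by move=> i j _ _ [x [/= -> ->]].
Qed.

(** Rounding down to a multiple of [e] gives finitely many values, because [f] is
    bounded. *)
Lemma measurable_bounded_approx (f : T -> R) (e : R) :
  measurable_fun setT f -> bounded_fun f -> 0 < e ->
  exists2 s, simple_mfun s & forall x, `|f x - s x| <= e.
Proof.
move=> mf bf e0.
have PF : ProperFilter (globally [set: T]) by exact: (@globally_properfilter _ _ point).
have /ex_bound[M /= fM] := bf; pose k x := Num.floor (f x / e).
have kx x : (k x)%:~R * e <= f x < ((k x) + 1)%:~R * e.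
  by rewrite -ler_pdivlMr// -ltr_pdivrMr// floor_itv// num_real.
have mk z : measurable (k @^-1` [set z]).
  rewrite (_ : _ @^-1` _ = f @^-1` `[z%:~R * e, (z + 1)%:~R * e[).
    by rewrite -[X in measurable X]setTI; exact: mf.
  apply/seteqP; split => x /=; rewrite in_itv/=; first by move=> <-.
  by rewrite -ler_pdivlMr// -ltr_pdivrMr// => zx; exact: floor_def.
have [N MN] : exists N : nat, M / e < N%:R.
  by exists (Num.bound (M / e)); exact: (le_lt_trans (ler_norm _) (ltr_norm_bound _)).
have fk : finite_set (range k).
  apply: (@sub_finite_set _ _ [set (i%:Z - N%:Z) | i in `I_(N + N)]); last first.
    exact/finite_image/finite_II.
  move=> _ [x _ <-].
  have /andP[lb ub] : - N%:R <= f x / e < N%:R.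
    have := fM x I; rewrite ler_norml => /andP[Mf fM'].
    rewrite -lerNl -mulNr; apply/andP; split.
      by rewrite (le_trans _ (ltW MN))// ler_pM2r ?invr_gt0// lerNl.
    by rewrite (le_lt_trans _ MN)// ler_pM2r ?invr_gt0.
  have kl : - N%:Z <= k x by rewrite floor_ge_int rmorphN.
  have kr : k x < N%:Z by rewrite floor_lt_int.
  by exists `|(k x + N%:Z)%R|%N => /=; lia.
exists (fun x => (k x)%:~R * e); last first.
  move=> x; rewrite ler_norml; have := kx x; rewrite rmorphD/= mulrDl mul1r.
  by move=> /andP[? ?]; apply/andP; split; lra.
split; last by rewrite -(image_comp k (fun z : int => z%:~R * e)); exact: finite_image.
move=> _ Y mY; rewrite setTI.
rewrite (_ : _ @^-1` _ = k @^-1` [set z | (z%:~R * e) \in Y]); last first.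
  by apply/seteqP; split => x /= h; [exact: mem_set|exact: set_mem].
by rewrite preimage_bigU//; exact: bigsetU_measurable.
Qed.
End finitely_additive.

(** * The weak-* topology *)

Section weak_star.
Context (d : measure_display) (T : measurableType d) (R : realType).
Implicit Types (mu : ba T R) (A B : set T).

Let simple_nbhs (f : T -> R) : set_system (T -> R) :=
  within (@simple_mfun _ T R) (nbhs (f : {uniform T -> R})).

Lemma nbhs_uniform_simple (f : T -> R) e : 0 < e ->
  simple_nbhs f [set t | simple_mfun t /\ forall x, `|f x - t x| < e].
Proof.
move=> e0; apply/uniform_nbhs.
exists [set xy | ball xy.1 e xy.2]; split; first exact: (entourage_ball R (PosNum e0)).
by move=> h /= fh sh; split => // x; exact: fh.
Qed.

Lemma nbhs_uniform_simple_proper (f : T -> R) :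
  measurable_fun setT f -> bounded_fun f -> ProperFilter (simple_nbhs f).
Proof.
move=> mf bf; apply: Build_ProperFilter_ex.
move=> P; rewrite /simple_nbhs/= => /uniform_nbhs[E].
rewrite -entourage_ballE => -[[e /= e0 eE] EP].
have e20 : 0 < e / 2 by rewrite divr_gt0.
have [s ss fs] := measurable_bounded_approx mf bf e20.
exists s; apply: (EP s) => //.
move=> x _; apply: eE => /=.
by rewrite /ball/= (le_lt_trans (fs x))// ltr_pdivrMr// ltr_pMr// ltr1n.
Qed.

(** The simple integrals form a Cauchy family near [f] by the Lipschitz bound. *)
Lemma ba_sintegral_cvg mu (f : T -> R) :
  measurable_fun setT f -> bounded_fun f -> cvg (ba_sintegral mu @ simple_nbhs f).
Proof.
move=> mf bf; have PF := nbhs_uniform_simple_proper mf bf.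
have [M M0 hM] := ba_bounded mu.
apply/cauchy_cvgP/cauchy_exP => e e0.
pose D := M *+ 2 + 1; have D0 : 0 < D by rewrite ltr_wpDl// mulrn_wge0.
have ed : 0 < e / D / 2 by rewrite !divr_gt0.
have [s ss fs] := measurable_bounded_approx mf bf ed.
exists (ba_sintegral mu s); apply: filterS (nbhs_uniform_simple f ed) => t [st ft].
rewrite /ball/=; apply: (@le_lt_trans _ _ (e / D * (M *+ 2))).
  apply: ba_sintegral_lip => // x.
  rewrite distrC -(subrK (f x) (t x)) -addrA (le_trans (ler_normD _ _))//.
  by rewrite [leRHS]splitr lerD// distrC ltW.
by rewrite mulrAC ltr_pdivrMr// ltr_pM2l// ltrDl.
Qed.

Lemma ba_integral_approx mu M (f s : T -> R) (e : R) : (forall A, `|mu A| <= M) ->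
  measurable_fun setT f -> bounded_fun f -> simple_mfun s ->
  (forall x, `|f x - s x| <= e) ->
  `|ba_integral mu f - ba_sintegral mu s| <= e * (M *+ 2).
Proof.
move=> hM mf bf ss fs; have PF := nbhs_uniform_simple_proper mf bf.
have M0 : 0 <= M by rewrite (le_trans _ (hM set0)).
pose D := M *+ 2 + 1; have D0 : 0 < D by rewrite ltr_wpDl// mulrn_wge0.
apply/ler_addgt0Pr => n n0; have n20 : 0 < n / 2 by rewrite divr_gt0.
have nd : 0 < n / 2 / D by rewrite divr_gt0.
have /cvgrPdist_lt/(_ _ n20) := ba_sintegral_cvg (mu := mu) mf bf.
move=> /(filterI (nbhs_uniform_simple f nd))/filter_ex[t /= [[st ft]]].
rewrite -/(ba_integral mu f) => Lt.
rewrite -(subrK (ba_sintegral mu t) (ba_integral mu f)) -addrA.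
rewrite (le_trans (ler_normD _ _))//.
suff : `|ba_sintegral mu t - ba_sintegral mu s| <= e * (M *+ 2) + n / 2.
  by move: Lt => /ltW; set a := `|_|; set b := `|_|; lra.
apply: (@le_trans _ _ ((e + n / 2 / D) * (M *+ 2))).
  apply: ba_sintegral_lip => // x.
  rewrite distrC -(subrK (f x) (s x)) -addrA (le_trans (ler_normD _ _))//.
  by rewrite lerD ?(ltW (ft x))// distrC.
rewrite mulrDl lerD2l mulrAC ler_pdivrMr// ler_pM2l// lerDl//.
Qed.

Lemma indic_simple A : measurable A -> simple_mfun (\1_A : T -> R).
Proof.
move=> mA; split; first exact: measurable_indic.
apply: (@sub_finite_set _ _ [set 0; 1]); last exact: finite_set2.
by move=> _ [x _ <-]; rewrite indicE; case: (x \in A); [right|left].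
Qed.

Lemma indic_bounded A : bounded_fun (\1_A : T -> R).
Proof.
have PF : ProperFilter (globally [set: T]) by exact: (@globally_properfilter _ _ point).
apply/ex_bound; exists 1 => x _ /=.
by rewrite indicE; case: (x \in A); rewrite ?normr1 ?normr0.
Qed.

Lemma ba_integral_indic mu A : measurable A -> ba_integral mu \1_A = mu A.
Proof.
move=> mA; have [M M0 hM] := ba_bounded mu.
have sA := indic_simple mA; have mfA := sA.1.
have := ba_integral_approx (e := 0) hM mfA (@indic_bounded A) sA _.
rewrite mul0r normr_le0 subr_eq0 => /(_ _)/eqP ->; last first.
  by move=> x; rewrite subrr normr0.
rewrite /ba_sintegral (fsbigE [:: 1])//=.
- rewrite big_cons big_nil/= mem_setT addr0 mul1r; congr (mu _).
  apply/seteqP; split => x /=; rewrite indicE; last by move=> /mem_set ->.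
  by case: (boolP (x \in A)) => [/set_mem//|_] /eqP; rewrite eq_sym oner_eq0.
- move=> x _; rewrite inE => x1; have [->|x0] := eqVneq x 0; first by rewrite mul0r.
  rewrite (_ : _ @^-1` _ = set0) ?ba0 ?mulr0//; apply/seteqP; split => // t /=.
  rewrite indicE; case: (t \in A) => /esym/eqP; first by rewrite (negbTE x1).
  by rewrite (negbTE x0).
Qed.

Lemma ba_pairing_continuous (f : @bounded_mfun _ T R) :
  continuous (fun mu : ba T R => ba_pairing mu f).
Proof.
move=> mu; apply: (@continuous_comp _ _ _ (@ba_pairing _ T R)
  (fun g : {ptws @bounded_mfun _ T R -> R} => g f)).
  exact: (@initial_continuous (ba T R) _ (@ba_pairing _ T R) mu).
exact: (@proj_continuous _ (fun _ : @bounded_mfun _ T R => R) f).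
Qed.

(** Evaluation at an event is the pairing with its indicator, hence weak-*
    continuous; all that follows uses the topology only through these maps and
    through [ba_cvgP]. *)
Lemma ba_eval_continuous A : continuous (fun mu : ba T R => mu A).
Proof.
have [mA|nA] := pselect (measurable A); last first.
  rewrite (_ : (fun _ => _) = cst 0); first exact: cst_continuous.
  by apply/funext => mu; exact: ba_nonmeasurable.
pose f : @bounded_mfun _ T R := exist _ (mindic R mA : {mfun T >-> R}) (mem_set (@indic_bounded A)).
rewrite (_ : (fun _ => _) = (fun mu => ba_pairing mu f)).
  exact: ba_pairing_continuous.
by apply/funext => mu; rewrite /ba_pairing /= ba_integral_indic.
Qed.

Lemma ba_cvgP (F : set_system (ba T R)) mu : ProperFilter F ->
  (forall f : @bounded_mfun _ T R, ba_integral nu (val f) @[nu --> F] --> ba_integral mu (val f)) ->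
  F --> mu.
Proof.
move=> PF Fmu.
have cF : {ptws, (@ba_pairing _ T R @ F) --> ba_pairing mu}.
  apply/cvg_sup => f W /= [_ [[B Bop <-] Bf BW]].
  have BN : nbhs (ba_integral mu (val f)) B by exact: open_nbhs_nbhs.
  suff : F [set nu | W (ba_pairing nu)] by [].
  have := Fmu f _ BN; rewrite nbhs_simpl/=; apply: filterS => nu; exact: BW.
move=> A /= [_ [[B Bop <-] Bmu BA]].
have : nbhs (ba_pairing mu : {ptws @bounded_mfun _ T R -> R}) B.
  by apply: open_nbhs_nbhs.
move/cF; rewrite nbhs_simpl/= => FB.
suff : F A by [].
by apply: filterS FB.
Qed.

End weak_star.

(** * Weak-* compactness of the closed convex hull *)

Section compactness.
Context (d : measure_display) (T : measurableType d) (R : realType).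
Implicit Types (mu : ba T R) (A B : set T).

Definition ba_prob : set (ba T R) :=
  [set mu | (forall A, 0 <= mu A) /\ mu setT = 1].

Lemma ba_le mu A B : (forall A, 0 <= mu A) ->
  measurable A -> measurable B -> A `<=` B -> mu A <= mu B.
Proof.
move=> mu0 mA mB AB; rewrite -(setDUK AB) baU ?lerDl ?setDIK//.
exact: measurableD.
Qed.

Lemma ba_prob_le1 mu A : ba_prob mu -> mu A <= 1.
Proof.
move=> [mu0 mu1]; have [mA|/ba_nonmeasurable ->//] := pselect (measurable A).
by rewrite -mu1 ba_le.
Qed.

Lemma ba_prob_norm_le1 mu A : ba_prob mu -> `|mu A| <= 1.
Proof. by move=> mup; rewrite ger0_norm ?ba_prob_le1//; case: mup. Qed.

(** Eventwise limits along an ultrafilter exist by compactness of [0, 1]; the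
    resulting set function is the weak-* limit because bounded functions are
    uniformly approximated by simple ones. *)
Section ultralimit.
Variables (U : set_system (ba T R)) (UU : UltraFilter U) (UP : U ba_prob).

Let ev A (nu : ba T R) : R := nu A.

Let eval_cvg A : cvg (ev A @ U).
Proof.
have PU : ProperFilter U by exact: ultra_proper.
have [|l [_ lc]] := @segment_compact R 0 1 (ev A @ U) _ _.
  suff : U [set nu | ev A nu \in `[0, 1]] by [].
  apply: filterS UP => nu nup /=; rewrite in_itv/= ba_prob_le1// andbT.
  exact: nup.1.
apply/cvg_ex; exists l => N Nl.
have [//|UN] := in_ultra_setVsetC (ev A @^-1` N) UU.
by have [x []] := lc (~` N) N UN Nl.
Qed.

Let lim_ A := lim (ev A @ U).

Let lim_pred : lim_ \in @ba_pred d T R.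
Proof.
have PU : ProperFilter U by exact: ultra_proper.
apply: mem_set; split.
- move=> A B mA mB AB; rewrite /lim_ -limD//; congr (lim _).
  rewrite (_ : ev (A `|` B) = ev A \+ ev B)//.
  by apply/funext => nu; exact: baU.
- exists 1 => A mA; rewrite ler_norml; apply/andP; split.
    apply: limr_ge; first exact: eval_cvg.
    by apply: filterS UP => nu [nu0 _]; rewrite (le_trans _ (nu0 A))// lerN10.
  apply: limr_le; first exact: eval_cvg.
  by apply: filterS UP => nu; exact: ba_prob_le1.
- move=> A nA; apply: cvg_lim => //.
  rewrite (_ : ev A = cst 0); first exact: cvg_cst.
  by apply/funext => nu; exact: ba_nonmeasurable.
Qed.

Let mu0 : ba T R := BA lim_pred.

Let mu0_prob : ba_prob mu0.
Proof.
have PU : ProperFilter U by exact: ultra_proper.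
split=> [A|].
  apply: limr_ge; first exact: eval_cvg.
  by apply: filterS UP => nu [nu0 _]; exact: nu0.
apply: cvg_lim => //; apply: cvg_near_cst.
by apply: filterS UP => nu [_].
Qed.

Lemma ba_prob_ultra_cvg : exists2 mu, ba_prob mu & U --> mu.
Proof.
have PU : ProperFilter U by exact: ultra_proper.
exists mu0 => //; apply: ba_cvgP => f.
have mf : measurable_fun setT (val f) by [].
have bf : bounded_fun (val f) by exact: set_mem (valP f).
apply/cvgrPdist_le => e e0.
have e80 : 0 < e / 8 by rewrite divr_gt0.
have [s ss fs] := measurable_bounded_approx mf bf e80.
have app nu : ba_prob nu ->
    `|ba_integral nu (val f) - ba_sintegral nu s| <= e / 8 * 2.
  by move=> nup; apply: ba_integral_approx => // A; exact: ba_prob_norm_le1.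
have sE nu : ba_sintegral nu s =
    \sum_(z <- fset_set (range s)) z * nu (s @^-1` [set z]).
  rewrite (_ : s = id \o s)// ba_sintegral_comp//; first by case: ss.
  by move=> z; exact: simple_preimage.
have : ba_sintegral nu s @[nu --> U] --> ba_sintegral mu0 s.
  rewrite sE (_ : (fun _ => _) = (fun nu : ba T R =>
      \sum_(z <- fset_set (range s)) z * nu (s @^-1` [set z]))); last first.
    by apply/funext => nu; exact: sE.
  apply: (cvg_big (op := +%R)) => [|z _]; first exact: add_continuous.
  apply: cvgM; first exact: cvg_cst.
  exact: eval_cvg.
have e20 : 0 < e / 2 by rewrite divr_gt0.
move=> /cvgrPdist_le/(_ _ e20) Us.
near=> nu.
have := app _ mu0_prob; have : ba_prob nu by near: nu.
move=> /app; have : `|ba_sintegral mu0 s - ba_sintegral nu s| <= e / 2 by near: nu.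
rewrite !ler_norml.
move=> /andP[? ?] /andP[? ?] /andP[? ?]; apply/andP; split; lra.
Unshelve. all: by end_near. Qed.

End ultralimit.

Lemma ba_prob_compact : compact ba_prob.
Proof.
rewrite compact_ultra => U UU UP.
by have [mu mup Umu] := ba_prob_ultra_cvg UU UP; exists mu.
Qed.

Lemma ba_sum_eval_continuous (I : Type) (s : seq I) (c : I -> R)
    (A : I -> set T) :
  continuous (fun mu : ba T R => \sum_(i <- s) c i * mu (A i)).
Proof.
have FF mu := @nbhs_filter (ba T R) mu.
move=> mu; apply: (@cvg_big _ _ _ _ _ _ _ (nbhs mu)) => [|i _].
  exact: add_continuous.
by apply: cvgM; [exact: cvg_cst|exact: ba_eval_continuous].
Qed.

Lemma ba_eval_conv (l : {i01 R}) (mu nu : convex_lmodType (ba T R)) A :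
  (mu <| l |> nu : ba T R) A =
  l%:num * (mu : ba T R) A + (1 - l%:num) * (nu : ba T R) A.
Proof. by []. Qed.

(** Constraints that are affine in finitely many values [mu (A i)] pass from a
    set to its closed convex hull; nonnegativity, total mass 1 and the
    e-variable inequality for simple functions are all of this form. *)
Lemma closure_hull_sum_le (K : set (ba T R)) (I : Type) (s : seq I) (c : I -> R)
    (A : I -> set T) b :
  (forall mu, K mu -> \sum_(i <- s) c i * mu (A i) <= b) ->
  forall mu, closure (convex_hull K) mu -> \sum_(i <- s) c i * mu (A i) <= b.
Proof.
move=> Kb; set S := [set mu : ba T R | \sum_(i <- s) c i * mu (A i) <= b].
suff : closure (convex_hull K) `<=` S by [].
have Scl : closed S.
  by apply: (closed_comp _ (@closed_le R b)) => mu _; exact: ba_sum_eval_continuous.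
rewrite [X in _ `<=` X](closure_id S).1//; apply: closure_subset.
apply: smallest_sub => // x y l /set_mem Sx /set_mem Sy; apply: mem_set.
pose sum (mu : ba T R) := \sum_(i <- s) c i * mu (A i).
have -> : S (x <| l |> y) = (l%:num * sum x + (1 - l%:num) * sum y <= b) :> Prop.
  rewrite /S/= /sum !mulr_sumr -big_split/=; congr (_ <= _ : Prop).
  apply: eq_bigr => i _.
  transitivity (c i * (l%:num * (x : ba T R) (A i)
                       + (1 - l%:num) * (y : ba T R) (A i))); first by [].
  by ring.
have l0 : 0 <= l%:num by [].
have l1 : 0 <= 1 - l%:num by rewrite subr_ge0.
by have := ler_wpM2l l0 Sx; have := ler_wpM2l l1 Sy; rewrite -/(sum x) -/(sum y); lra.
Qed.

Lemma closure_hull_ba_prob (K : set (ba T R)) :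
  K `<=` ba_prob -> closure (convex_hull K) `<=` ba_prob.
Proof.
move=> KP mu Kmu; have le1 c A b :
    (forall nu, K nu -> c * nu A <= b) -> c * mu A <= b.
  move=> cb; have := @closure_hull_sum_le K unit [:: tt] (fun=> c) (fun=> A) b _ mu Kmu.
  by rewrite big_seq1; apply => nu Kn; rewrite big_seq1 cb.
split=> [A|].
  have := @le1 (-1) A 0; rewrite mulN1r oppr_le0; apply => nu /KP[nu0 _].
  by rewrite mulN1r oppr_le0.
apply/le_anti/andP; split.
  by have := @le1 1 setT 1; rewrite mul1r; apply => nu /KP[_ ->]; rewrite mulr1.
have := @le1 (-1) setT (-1); rewrite mulN1r lerN2; apply => nu /KP[_ ->].
by rewrite mulr1.
Qed.

End compactness.
Arguments ba_prob {d T R}.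

Lemma closed_cluster (U : topologicalType) (F : set_system U) (S : set U) x :
  closed S -> F S -> cluster F x -> S x.
Proof.
by move=> Scl FS; rewrite clusterE => /(_ S FS); rewrite -(closure_id S).1.
Qed.

(** * Dual formula for the relative entropy *)

Section entropy_duality.
Context (R : realType).

(** Young's inequality for [q * ln q]; with [u := t - ln (q / p)] it amounts to
    [1 + u <= expR u]. *)
Lemma entropy_term_ge (q p t : R) : 0 <= q -> 0 <= p ->
  ((q * (t + 1) - p * expR t)%:E <= entropy_term q p)%E.
Proof.
move=> q0 p0; rewrite /entropy_term.
have [->|qn0] := eqVneq q 0.
  by rewrite mul0r add0r lee_fin oppr_le0 mulr_ge0 ?expR_ge0.
have [->|pn0] := eqVneq p 0; first by rewrite leey.
have qp : 0 < q by rewrite lt_neqAle eq_sym qn0.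
have pp : 0 < p by rewrite lt_neqAle eq_sym pn0.
have qpp : 0 < q / p by rewrite divr_gt0.
rewrite lee_fin; pose u := t - ln (q / p).
have -> : expR t = expR u * (q / p).
  by rewrite -[q / p in RHS]lnK ?posrE// -expRD subrK.
have -> : p * (expR u * (q / p)) = q * expR u.
  by rewrite mulrCA [p * _]mulrC divfK// mulrC.
by have := ler_wpM2l q0 (expR_ge1Dx u); rewrite /u; lra.
Qed.

(** The inequality of [entropy_term_ge] is sharp: the optimal [t] is
    [ln (q / p)] for positive masses, tends to -oo when [q = 0] and to +oo when
    [p = 0 < q]. *)
Lemma entropy_term_approx (q p x : R) : 0 <= q -> 0 <= p ->
  (x%:E < entropy_term q p)%E -> exists t, x < q * (t + 1) - p * expR t.
Proof.
move=> q0 p0; rewrite /entropy_term.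
have [->|qn0] := eqVneq q 0.
  rewrite lte_fin => x0; exists (ln (- x / (p + 1))).
  have p1 : 0 < p + 1 by rewrite ltr_wpDl.
  rewrite lnK ?posrE ?divr_gt0 ?oppr_gt0// mul0r add0r mulrA ltrNr.
  by rewrite ltr_pdivrMr// mulrC ltr_pM2l ?oppr_gt0// ltrDl.
have qp : 0 < q by rewrite lt_neqAle eq_sym qn0.
have [->|pn0] := eqVneq p 0.
  by move=> _; exists (x / q); rewrite mul0r subr0 mulrDr mulrC divfK// ltrDl mulr1.
have pp : 0 < p by rewrite lt_neqAle eq_sym pn0.
rewrite lte_fin => xq; exists (ln (q / p)).
by rewrite lnK ?posrE ?divr_gt0// mulrCA mulfV// mulrDr !mulr1 addrK.
Qed.

Lemma entropy_term_gtNy (q p : R) : (-oo < entropy_term q p)%E.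
Proof. by rewrite /entropy_term; case: ifP => // _; case: ifP => // _; rewrite ltNyr. Qed.

(** A sum of suprema is bounded as soon as the sums of approximants are, even
    when some terms are infinite. *)
Lemma sume_le_approx n (e : 'I_n -> \bar R) (h : R) : (forall i, -oo < e i)%E ->
  (forall x : 'I_n -> R, (forall i, ((x i)%:E < e i)%E) -> \sum_(i < n) x i <= h) ->
  (\sum_(i < n) e i <= h%:E)%E.
Proof.
elim: n e h => [|n IH] e h eNy eh.
  by rewrite big_ord0 lee_fin; have := eh (fun=> 0); rewrite big_ord0; apply; case.
rewrite big_ord_recl; set S := (\sum_(i < n) _)%E.
have Sle x0 : (x0%:E < e ord0)%E -> (S <= (h - x0)%:E)%E.
  move=> x0e; apply: IH => [i|x xe]; first exact: eNy.
  have := eh (fun i => oapp x x0 (unlift ord0 i)).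
  rewrite big_ord_recl unlift_none/=.
  under eq_bigr do rewrite liftK/=.
  rewrite -lerBrDl; apply => i.
  by case: unliftP => [j ->|->] /=; [exact: xe|exact: x0e].
have SNy : (-oo < S)%E.
  by rewrite /S; elim/big_ind : _ => // -[x| |] [y| |]// _ _; rewrite -EFinD ltNyr.
have between (y : R) (z : \bar R) : (y%:E < z)%E -> exists2 x, y < x & (x%:E < z)%E.
  case: z => [z|_|]//; last by exists (y + 1); rewrite ?ltrDl ?ltry.
  rewrite lte_fin => yz; exists ((y + z) / 2); first by rewrite midf_lt.
  by rewrite lte_fin midf_lt.
have [x0 x0e] : exists x0 : R, (x0%:E < e ord0)%E.
  have := eNy ord0; case: (e ord0) => [z|_|]//.
    by exists (z - 1); rewrite lte_fin ltrBlDr ltrDl.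
  by exists 0; rewrite ltry.
have Sx0 := Sle _ x0e; clearbody S; case: S Sx0 SNy Sle => // s _ _ Sle.
rewrite leNgt; apply/negP; rewrite -lteBlDr// -EFinB => /between[x hx /Sle].
by rewrite lee_fin; lra.
Qed.

End entropy_duality.

Section relative_entropy_duality.
Context (d : measure_display) (T : measurableType d) (R : realType).
Implicit Types (mu nu : ba T R).

(** Donsker-Varadhan formula on finite partitions.  On the right-hand side empty
    blocks are allowed, so that partitions can be built from sets that are not
    known to be nonempty. *)
Lemma relative_entropy_leP nu mu (h : R) :
  (forall A, 0 <= nu A) -> (forall A, 0 <= mu A) ->
  (relative_entropy nu mu <= h%:E)%E <->
  forall n (A : 'I_n -> set T) (t : 'I_n -> R),
    (forall i, measurable (A i)) -> trivIset setT A -> \bigcup_i A i = setT ->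
    \sum_(i < n) (nu (A i) * (t i + 1) - mu (A i) * expR (t i)) <= h.
Proof.
move=> nu0 mu0; split=> [Hh n A t mA tA AT|DV].
  pose J := [set i : 'I_n | `[< A i !=set0 >] ]%SET.
  pose g i := nu (A i) * (t i + 1) - mu (A i) * expR (t i).
  have -> : \sum_(i < n) g i = \sum_(i in J) g i.
    rewrite (bigID (fun i => i \in J))/= [X in _ + X]big1 ?addr0// => i.
    rewrite inE => /asboolPn/set0P/negP/negPn/eqP A0.
    by rewrite /g A0 !ba0 !mul0r subrr.
  rewrite big_enum_val/= -lee_fin (le_trans _ Hh)//.
  rewrite -sumEFin; apply: (@le_trans _ _ (\sum_(i < #|J|)
      entropy_term (nu (A (enum_val i))) (mu (A (enum_val i))))%E).
    by apply: lee_sum => i _; exact: entropy_term_ge.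
  apply: ereal_sup_ubound; exists #|J|, (fun i => A (enum_val i)); split => //.
  split => [|i j _ _ Aij|i _].
  - apply/seteqP; split => // x _.
    have [i _ Aix] : (\bigcup_i A i) x by rewrite AT.
    have iJ : i \in J by rewrite inE; apply/asboolP; exists x.
    by exists (enum_rank_in iJ i) => //; rewrite enum_rankK_in.
  - by apply: enum_val_inj; exact: tA.
  - by have := enum_valP i; rewrite inE => /asboolP.
apply: ge_ereal_sup => _ [n [A [mA [AT tA A0] ->]]].
apply: sume_le_approx => [i|x xe]; first exact: entropy_term_gtNy.
have /choice[t xt] i := entropy_term_approx (nu0 (A i)) (mu0 (A i)) (xe i).
by apply: le_trans (DV n A t mA tA AT); apply: ler_sum => i _; exact/ltW.
Qed.

End relative_entropy_duality.

(** * Domination of the effective null by the closed convex hull *)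

Section support.
Context (R : realType).

Lemma pos_part_sq_le (x y : R) :
  Num.max (x - y) 0 ^+ 2 <= (Num.max x 0 - y) ^+ 2.
Proof.
case: (leP (x - y) 0) => xy; first by rewrite expr0n sqr_ge0.
have xyle : x - y <= Num.max x 0 - y by rewrite lerD2r le_max lexx.
by rewrite ler_sqr ?nnegrE// ?(le_trans (ltW xy))// ltW.
Qed.

(** Let [F k] be the sum of the squares of the positive parts [w i] of
    [a i - k i], and [D] its infimum over [V].  If [a] cannot be dominated up to
    [e], then [D >= e ^+ 2 > 0].  At a near-minimiser [k], moving by a small step
    [l] towards [k'] cannot lower [F] much, whereas
    [F (k + l (k' - k)) <= F k - 2 l X + l ^+ 2 n] with
    [X := \sum_i w i * (k' i - k i)]; hence [X <= D / 2] for every [k'], while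
    [\sum_i w i * (a i - k i) = F k >= D]. *)
Lemma dominate_or_separate n (V : set ('I_n -> R)) (a : 'I_n -> R) (e : R) :
  V !=set0 ->
  (forall k k' l, V k -> V k' -> 0 <= l <= 1 ->
     V (fun i => k i + l * (k' i - k i))) ->
  (forall k, V k -> forall i, 0 <= k i <= 1) -> 0 < e ->
  (exists2 k, V k & forall i, a i <= k i + e) \/
  exists w : 'I_n -> R, (forall i, 0 <= w i) /\
    exists c, [/\ 0 < c, c < \sum_(i < n) w i * a i &
      forall k, V k -> \sum_(i < n) w i * k i <= c].
Proof.
move=> [v0 Vv0] Vconv V01 e0.
have [|nk] := pselect (exists2 k, V k & forall i, a i <= k i + e); first by left.
right; pose F k := \sum_(i < n) Num.max (a i - k i) 0 ^+ 2.
have F0 k : 0 <= F k by apply: sumr_ge0 => i _; exact: sqr_ge0.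
have Fe k : V k -> e ^+ 2 <= F k.
  move=> Vk; have [i ki] : exists i, k i + e < a i.
    apply: contrapT => h; apply: nk; exists k => // i; rewrite leNgt.
    by apply/negP => ?; apply: h; exists i.
  rewrite /F (bigD1 i)//= ler_wpDr ?sumr_ge0// => [j _|]; first exact: sqr_ge0.
  have ea : e <= a i - k i by rewrite lerBrDl ltW.
  by rewrite ler_sqr ?nnegrE ?le_max ?ea// ?lexx ?orbT// ltW.
pose D := inf [set F k | k in V].
have FV : has_inf [set F k | k in V].
  by split; [exists (F v0), v0|exists 0 => _ [k _ <-]].
have D0 : 0 < D.
  apply: (@lt_le_trans _ _ (e ^+ 2)); first by rewrite exprn_gt0.
  by apply: lb_le_inf FV.1 _ => _ [k Vk <-]; exact: Fe.
have DF k : V k -> D <= F k.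
  by move=> Vk; apply: ge_inf; [case: FV|exists k].
(* The step has to satisfy [l <= 1], to stay in [V], and [l * n <= D / 2], to
   keep the contribution of the quadratic error to the bound on [X] within
   [D / 4]; the tolerance [l * D / 2] on the infimum contributes the other [D / 4]. *)
pose l := D / (n%:R *+ 2 + D).
have n0 : 0 <= n%:R :> R by [].
have den0 : 0 < n%:R *+ 2 + D by rewrite ltr_wpDl// mulrn_wge0.
have l0 : 0 < l by rewrite divr_gt0.
have l1 : l <= 1 by rewrite ler_pdivrMr// mul1r lerDr mulrn_wge0.
have ln : l * n%:R <= D / 2.
  rewrite mulrAC ler_pdivrMr// mulrDr -mulr_natr.
  have : 0 <= D / 2 * D by rewrite mulr_ge0 ?divr_ge0// ltW.
  by lra.
have lD : 0 < l * D / 2 by rewrite divr_gt0// mulr_gt0.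
have [_ [k Vk <-]] := inf_adherent lD FV; rewrite -/D => Fk.
pose w i := Num.max (a i - k i) 0.
have w0 i : 0 <= w i by rewrite le_max lexx orbT.
have wk0 : 0 <= \sum_(i < n) w i * k i.
  by apply: sumr_ge0 => i _; rewrite mulr_ge0//; have /andP[] := V01 _ Vk i.
exists w; split => //; exists (\sum_(i < n) w i * k i + D / 2); split.
- by rewrite ltr_wpDl// divr_gt0.
- rewrite addrC -ltrBrDr -sumrB.
  have -> : \sum_(i < n) (w i * a i - w i * k i) = F k.
    apply: eq_bigr => i _; rewrite -mulrBr /w.
    by case: leP => ?; rewrite ?mul0r ?expr0n// expr2.
  by apply: lt_le_trans (DF _ Vk); rewrite ltr_pdivrMr// ltr_pMr// ltr1n.
move=> k' Vk'; pose X := \sum_(i < n) w i * (k' i - k i).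
suff X2 : X <= D / 2.
  by rewrite addrC -lerBlDr -sumrB; under eq_bigr do rewrite -mulrBr.
have Vkl : V (fun i => k i + l * (k' i - k i)) by apply: Vconv; rewrite // ltW.
have : D <= F k - l * X * 2 + l ^+ 2 * n%:R.
  apply: le_trans (DF _ Vkl) _.
  have -> : l ^+ 2 * n%:R = \sum_(i < n) l ^+ 2.
    by rewrite sumr_const card_ord mulr_natr.
  rewrite /F /X mulr_sumr mulr_suml -sumrB -big_split/=.
  apply: ler_sum => i _; rewrite opprD addrA.
  apply: le_trans (pos_part_sq_le _ _) _; rewrite -/(w i).
  have : (k' i - k i) ^+ 2 <= 1.
    have /andP[? ?] := V01 _ Vk i; have /andP[? ?] := V01 _ Vk' i.
    rewrite -[leLHS]ger0_norm ?sqr_ge0// normrX exprn_ile1// ler_norml.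
    by apply/andP; split; lra.
  move=> /(ler_wpM2l (sqr_ge0 l)); lra.
move=> h; have {h} : l * (X * 2) <= l * (D / 2 + l * n%:R).
  by rewrite expr2 in h; lra.
by rewrite ler_pM2l//; lra.
Qed.

End support.

Section domination.
Context (d : measure_display) (T : measurableType d) (R : realType).
Implicit Types (mu nu : ba T R).

Lemma ba_of_measureE (p : {finite_measure set T -> \bar R}) A :
  measurable A -> ba_of_measure p A = fine (p A).
Proof. by move=> mA; rewrite /= mem_set. Qed.

Lemma ba_of_measure_ge0 (p : {finite_measure set T -> \bar R}) A :
  0 <= ba_of_measure p A.
Proof. by rewrite /=; case: ifP => // _; exact: fine_ge0. Qed.

Lemma ba_of_measure_prob (p : probability T R) : ba_prob (ba_of_measure p).
Proof.
split; first exact: ba_of_measure_ge0.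
by rewrite ba_of_measureE//; rewrite -[1]/(fine 1%E) -(probability_setT p).
Qed.

Let simple_sum n (A : 'I_n -> set T) (w : 'I_n -> R) (x : T) : \bar R :=
  (\sum_(i < n) (w i * \1_(A i) x)%:E)%E.

Lemma integral_simple_sum (p : {finite_measure set T -> \bar R}) n
    (A : 'I_n -> set T) (w : 'I_n -> R) :
  (forall i, measurable (A i)) -> (forall i, 0 <= w i) ->
  (\int[p]_x simple_sum A w x = (\sum_(i < n) w i * ba_of_measure p (A i))%:E)%E.
Proof.
move=> mA w0; rewrite ge0_integral_sum//; last 2 first.
  - move=> i; apply/measurable_EFinP; exact: measurable_funM.
  - by move=> i x _; rewrite lee_fin mulr_ge0.
rewrite -sumEFin; apply: eq_bigr => i _.
under eq_integral do rewrite EFinM.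
rewrite ge0_integralZl//; last 2 first.
  - by apply/measurable_EFinP; exact: measurable_indic.
  - by rewrite lee_fin.
by rewrite integral_indic// setIT ba_of_measureE// EFinM fineK// fin_num_measure.
Qed.

Lemma convex_hull_conv (K : set (ba T R)) mu nu (l : R) :
  convex_hull K mu -> convex_hull K nu -> 0 <= l <= 1 ->
  exists2 rho, convex_hull K rho & forall A, rho A = mu A + l * (nu A - mu A).
Proof.
move=> Kmu Knu /andP[l0 l1]; pose l01 : {i01 R} := Itv01 l0 l1.
exists ((nu : convex_lmodType (ba T R)) <| l01 |> mu : ba T R).
  move=> S [Sconv KS]; apply/set_mem/Sconv; apply/mem_set.
    exact: Knu.
  exact: Kmu.
by move=> A; rewrite (ba_eval_conv l01 nu mu A)/=; ring.
Qed.

Variables (P : set (probability T R)) (P0 : P !=set0).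
Let K : set (ba T R) := [set ba_of_measure p | p in P].

Let K_prob : K `<=` ba_prob.
Proof. by move=> _ [p _ <-]; exact: ba_of_measure_prob. Qed.

Let sub_hull : K `<=` convex_hull K.
Proof. exact: sub_smallest. Qed.

Let hull_prob : convex_hull K `<=` ba_prob.
Proof.
by apply: subset_trans (closure_hull_ba_prob K_prob); exact: subset_closure.
Qed.

(** A separating weight [w] with level [c] would make [\sum_i (w i / c) 1_(A i)]
    an e-variable of [p]-integral greater than 1. *)
Lemma effective_null_approx (p : {finite_measure set T -> \bar R}) n
    (A : 'I_n -> set T) e :
  effective_null P p -> (forall i, measurable (A i)) -> 0 < e ->
  exists2 nu, convex_hull K nu & forall i, ba_of_measure p (A i) <= nu (A i) + e.
Proof.
move=> Pp mA e0.
pose V := [set (fun i => (nu : ba T R) (A i)) | nu in convex_hull K].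
have [| | |//|[_ [nu Knu <-] ha]|[w [w0 [c [c0 ca cV]]]]] :=
    @dominate_or_separate R n V (fun i => ba_of_measure p (A i)) e.
- have [q Pq] := P0; exists (fun i => ba_of_measure q (A i)).
  by exists (ba_of_measure q) => //; apply: sub_hull; exists q.
- move=> _ _ l [mu Kmu <-] [nu Knu <-] l01.
  have [rho Krho rhoE] := convex_hull_conv Kmu Knu l01.
  by exists rho => //; apply/funext => i.
- move=> _ [nu /hull_prob nup <-] i; rewrite ba_prob_le1// andbT.
  by case: nup.
- by exists nu.
exfalso; have wc0 i : 0 <= w i / c by rewrite divr_ge0// ltW.
have eX : evariable P (simple_sum A (fun i => w i / c)).
  split.
  - apply: emeasurable_sum => i; apply/measurable_EFinP.
    exact: measurable_funM.
  - by move=> x; apply: sume_ge0 => i _; rewrite lee_fin mulr_ge0.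
  - move=> q Pq; rewrite integral_simple_sum// lee_fin.
    under eq_bigr do rewrite mulrAC.
    rewrite -mulr_suml ler_pdivrMr// mul1r.
    apply: (cV (fun i => ba_of_measure q (A i))); exists (ba_of_measure q) => //.
    by apply: sub_hull; exists q.
have := Pp _ eX; rewrite integral_simple_sum// lee_fin.
under eq_bigr do rewrite mulrAC.
by rewrite -mulr_suml ler_pdivrMr// mul1r leNgt ca.
Qed.

Lemma closure_hull_compact : compact (closure (convex_hull K)).
Proof.
apply: subclosed_compact (@ba_prob_compact _ T R) _; first exact: closed_closure.
exact: closure_hull_ba_prob.
Qed.

(** The requirements of [effective_null_approx], indexed by finite families of
    events and tolerances, form a filter base in a compact set; any cluster point
    satisfies them all. *)
Lemma effective_null_dominated (p : {finite_measure set T -> \bar R}) :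
  effective_null P p -> exists2 mu, closure (convex_hull K) mu &
    forall A, measurable A -> ba_of_measure p A <= mu A.
Proof.
move=> Pp; pose C := closure (convex_hull K).
pose D := [set se : seq (set T) * R |
  (forall A, A \in se.1 -> measurable A) /\ 0 < se.2].
pose B (se : seq (set T) * R) := [set mu : ba T R |
  C mu /\ forall A, A \in se.1 -> ba_of_measure p A <= mu A + se.2].
have FF : ProperFilter (filter_from D B).
  apply: filter_from_proper.
    apply: filter_from_filter; first by exists ([::], 1); split.
    move=> [s e] [s' e'] [/= ms e0] [/= ms' e0'].
    exists (s ++ s', Num.min e e').
      split=> /= [A|]; last by rewrite lt_min e0.
      by rewrite mem_cat => /orP[/ms|/ms'].
    move=> mu [/= Cmu h]; split; split=> // A /= As.
      by rewrite (le_trans (h A _)) ?mem_cat ?As// lerD2l ge_min lexx.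
    by rewrite (le_trans (h A _)) ?mem_cat ?As ?orbT// lerD2l ge_min lexx orbT.
  move=> [s e] [/= ms e0].
  have [|nu Knu h] := @effective_null_approx p (size s) (fun i => nth set0 s i) e Pp _ e0.
    by move=> i; apply: ms; rewrite mem_nth.
  exists nu; split; first exact: subset_closure.
  move=> A /= As; have si : (index A s < size s)%N by rewrite index_mem.
  by have := h (Ordinal si); rewrite nth_index.
have FC : filter_from D B C by exists ([::], 1) => [|mu []//]; split.
have [mu [Cmu clmu]] := closure_hull_compact FF FC.
exists mu => // A mA; apply/ler_addgt0Pr => e e0.
have : closed [set mu : ba T R | ba_of_measure p A - e <= mu A].
  by apply: (closed_comp _ (@closed_ge R _)) => nu _; exact: ba_eval_continuous.
move=> /closed_cluster/(_ _ clmu); rewrite /= lerBlDr; apply.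
exists ([:: A], e) => [|nu [_ /(_ A)]]; last by rewrite /= mem_head lerBlDr; apply.
by split=> // A' /=; rewrite inE => /eqP ->.
Qed.

End domination.

(** * The countably additive part of a charge *)

Section sigma_additive_part.
Context (d : measure_display) (T : measurableType d) (R : realType).
Implicit Types (A B : set T).

Section outer.
Variables (mu : ba T R) (mu0 : forall A, 0 <= mu A).

Let muE A : \bar R := (mu A)%:E.
Let muE_ge0 A : (0 <= muE A)%E. Proof. by rewrite lee_fin. Qed.
Let muE_set0 : muE set0 = 0%E. Proof. by rewrite /muE ba0. Qed.

(** On events, this is the infimum of [\sum_k mu (A k)] over countable covers:
    for nonnegative [mu], the largest countably additive measure below it. *)
Definition sigma_outer : set T -> \bar R := mu_ext (fun A => (mu A)%:E).

HB.instance Definition _ := isOuterMeasure.Build R T sigma_outer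
  (mu_ext0 muE_set0 muE_ge0) (mu_ext_ge0 muE_ge0) (le_mu_ext muE)
  (mu_ext_sigma_subadditive muE_ge0).

Lemma sigma_outer_le A : measurable A -> (sigma_outer A <= (mu A)%:E)%E.
Proof.
move=> mA; apply: ereal_inf_lbound.
exists (fun n => if n is 0%N then A else set0).
  by split=> [[]// _|t At]; exists 0%N.
apply/cvg_lim => //; rewrite -cvg_shiftS.
rewrite (_ : [sequence _]_n = cst (mu A)%:E); first exact: cvg_cst.
by rewrite funeqE => n /=; rewrite big_nat_recl//= big1 ?adde0// => i _; rewrite ba0.
Qed.

(** Finite additivity of [mu] suffices, since an event splits every member of a
    countable cover additively. *)
Lemma sigma_outer_caratheodory A : measurable A ->
  caratheodory_measurable sigma_outer A.
Proof.
move=> mA; apply: le_caratheodory_measurable => X.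
apply: le_ereal_inf_tmp => _ [B [mB XB] <-].
have BE k : muE (B k) = (muE (B k `&` A) + muE (B k `&` ~` A))%E.
  rewrite /muE -EFinD -baU; first by rewrite -setIUr setUCr setIT.
  - exact: measurableI.
  - by apply: measurableI => //; exact: measurableC.
  - by rewrite setIACA setICr setI0.
rewrite (eq_eseriesr (fun k _ => BE k)) nneseriesD//.
apply: leeD; apply: ereal_inf_lbound.
  exists (fun k => B k `&` A) => //; split=> [k|]; first exact: measurableI.
  by rewrite -setI_bigcupl; exact: setSI.
exists (fun k => B k `&` ~` A) => //; split=> [k|].
  by apply: measurableI => //; exact: measurableC.
by rewrite -setI_bigcupl; exact: setSI.
Qed.

Let sigma_outer_sigma_additive : semi_sigma_additive sigma_outer.
Proof.
move=> F mF tF mUF.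
apply: (@caratheodory_measure_sigma_additive R T sigma_outer F) => //.
  by move=> i; exact: sigma_outer_caratheodory.
exact: sigma_outer_caratheodory.
Qed.

HB.instance Definition _ := isMeasure.Build _ T R sigma_outer
  (outer_measure0 sigma_outer) (outer_measure_ge0 sigma_outer)
  sigma_outer_sigma_additive.

Let sigma_outer_fin : fin_num_fun sigma_outer.
Proof.
move=> A mA; rewrite ge0_fin_numE ?outer_measure_ge0//.
by rewrite (le_lt_trans (sigma_outer_le mA))// ltry.
Qed.

HB.instance Definition _ := Measure_isFinite.Build _ T R sigma_outer
  sigma_outer_fin.

Definition sigma_part : {finite_measure set T -> \bar R} := sigma_outer.

End outer.

End sigma_additive_part.

Section sigma_part_properties.
Context (d : measure_display) (T : measurableType d) (R : realType).
Implicit Types (mu nu : ba T R) (A B : set T).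

Lemma ba_bigU_le mu (I : Type) (s : seq I) (F : I -> set T) :
  (forall A, 0 <= mu A) -> (forall i, measurable (F i)) ->
  mu (\big[setU/set0]_(i <- s) F i) <= \sum_(i <- s) mu (F i).
Proof.
move=> mu0 mF; elim: s => [|i s IH]; first by rewrite !big_nil ba0.
have mU : measurable (\big[setU/set0]_(i <- s) F i).
  by apply: bigsetU_measurable.
rewrite !big_cons; apply: le_trans (lerD (lexx _) IH).
rewrite -[_ `|` _](setDUK (@subsetUl _ (F i) (\big[setU/set0]_(i <- s) F i))).
have mD : measurable ((F i `|` \big[setU/set0]_(i <- s) F i) `\` F i).
  by apply: measurableD => //; exact: measurableU.
rewrite baU ?setDIK// lerD2l ba_le//.
by move=> x [[]].
Qed.

(** [C] is the union, within [B], of the first members of a countable cover of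
    [B] that is nearly optimal for [sigma_part]; countable additivity of [Q]
    makes what is left of [B] small. *)
Lemma sigma_part_approx mu (mu0 : forall A, 0 <= mu A) (Q : probability T R) B e :
  measurable B -> 0 < e -> exists C, [/\ measurable C, C `<=` B,
    mu C <= ba_of_measure (sigma_part mu0) B + e &
    ba_of_measure Q (B `\` C) <= e].
Proof.
move=> mB e0.
have fB : sigma_outer mu B \is a fin_num by exact: (fin_num_measure (sigma_part mu0)).
have [_ [F [mF BF] <-] Fe] := lb_ereal_inf_adherent e0 fB.
have [N NQ] : exists N, ba_of_measure Q (B `\` \big[setU/set0]_(i < N) F i) <= e.
  pose G k := B `&` \big[setU/set0]_(i < k) F i.
  have mU k : measurable (\big[setU/set0]_(i < k) F i).
    by apply: bigsetU_measurable.
  have mG k : measurable (G k) by exact: measurableI.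
  have GB : \bigcup_k G k = B.
    apply/seteqP; split => [x [k _ []//]|x Bx].
    have [i _ Fix] := BF _ Bx; exists i.+1 => //; split => //.
    by rewrite -bigcup_mkord; exists i => /=.
  have ndG : nondecreasing_seq G.
    move=> k k' kk'; apply/subsetPset; apply: setIS => x.
    rewrite -!bigcup_mkord => -[i /= ik Fix]; exists i => //=.
    exact: leq_trans kk'.
  have := nondecreasing_cvg_mu (mu := Q) mG _ ndG; rewrite GB => /(_ mB).
  have /fineK <- : (Q : {measure set T -> \bar R}) B \is a fin_num.
    exact: fin_num_measure.
  move=> /fine_cvg/cvgrPdist_le/(_ _ e0)[N _ /(_ N (leqnn N)) h].
  exists N; apply: (@le_trans _ _ (ba_of_measure Q B - ba_of_measure Q (G N))).
    rewrite lerBrDr -baU; last 3 first.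
    - exact: measurableD.
    - exact: mG.
    - by rewrite /G setIC -setIA setDIK setI0.
    apply: ba_le => //; first exact: ba_of_measure_ge0.
      by apply: measurableU; [exact: measurableD|exact: mG].
    by move=> x [[]|[]].
  by rewrite !ba_of_measureE// (le_trans (ler_norm _)).
exists (B `&` \big[setU/set0]_(i < N) F i).
have mU : measurable (\big[setU/set0]_(i < N) F i).
  by apply: bigsetU_measurable.
split; [exact: measurableI|exact: subIsetl| |by rewrite setDIr setDv set0U].
rewrite ba_of_measureE//.
apply: (@le_trans _ _ (mu (\big[setU/set0]_(i < N) F i))).
  by apply: ba_le => //; exact: measurableI.
apply: le_trans (ba_bigU_le _ mu0 _) _; first by move=> i; exact: mF.
rewrite -lee_fin EFinD fineK//; apply: ltW; apply: le_lt_trans Fe.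
rewrite -sumEFin; apply: le_trans (nneseries_lim_ge N _) => //.
  by rewrite big_mkord.
by move=> k _ _; rewrite lee_fin.
Qed.

Lemma sintegral_finE (p : {finite_measure set T -> \bar R}) (h : {nnsfun T >-> R}) :
  sintegral p h =
  (\sum_(x <- fset_set (range h)) x * ba_of_measure p (h @^-1` [set x]))%:E.
Proof.
have fh : finite_set (range h) by [].
rewrite sintegralE fsbig_finite// -sumEFin; apply: eq_bigr => x _.
have mh : measurable (h @^-1` [set x]) by [].
by rewrite ba_of_measureE// EFinM fineK// fin_num_measure.
Qed.

(** By monotone approximation only simple functions [h] below an e-variable
    matter; their integral against [mu] is at most 1 because this holds on [P]
    and is a finite affine constraint. *)
Lemma sigma_part_effective_null (P : set (probability T R)) mu
    (mu0 : forall A, 0 <= mu A) :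
  closure (convex_hull [set ba_of_measure p | p in P]) mu ->
  effective_null P (sigma_part mu0).
Proof.
move=> Cmu X [mX X0 XP]; rewrite ge0_integralTE//; apply: ge_ereal_sup => _ [h hX <-].
rewrite sintegral_finE lee_fin.
apply: (@le_trans _ _ (\sum_(x <- fset_set (range h)) x * mu (h @^-1` [set x]))).
  rewrite big_seq [leRHS]big_seq; apply: ler_sum => x.
  rewrite in_fset_set// => /set_mem[t _ <-].
  have mh : measurable (h @^-1` [set h t]) by [].
  rewrite ler_wpM2l// ba_of_measureE// -lee_fin fineK; first exact: sigma_outer_le.
  exact: fin_num_measure.
apply: (closure_hull_sum_le (c := id) _ Cmu) => _ [p Pp <-].
rewrite -lee_fin -sintegral_finE (le_trans _ (XP _ Pp))//.
by rewrite ge0_integralTE//; apply: ereal_sup_ubound; exists h.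
Qed.

Lemma le_ereal_EFin (x y : \bar R) :
  (forall h : R, (y <= h%:E)%E -> (x <= h%:E)%E) -> (x <= y)%E.
Proof.
case: y => [y|_|xy]; [by apply|exact: leey|].
case: x xy => // [r|] xy; last by have := xy 0 (leNye _).
by have := xy (r - 1) (leNye _); rewrite lee_fin lerBrDr gerDl leNgt ltr01.
Qed.

(** A partition [A] is replaced by the sets [C i] of [sigma_part_approx] together
    with the remainder [S], on which the dual variable is a constant [s].  The
    dual sum for [mu] and this new partition is at least the one for [sigma_part]
    and [A] minus [expR s + e * D], where [e] tends to 0 first and [s] to -oo
    afterwards. *)
Lemma sigma_part_entropy mu (mup : ba_prob mu) (Q : probability T R) :
  (relative_entropy (ba_of_measure Q) (ba_of_measure (sigma_part mup.1))
   <= relative_entropy (ba_of_measure Q) mu)%E.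
Proof.
set nu := ba_of_measure Q; set mc := ba_of_measure _.
have nu0 : forall A, 0 <= nu A by exact: ba_of_measure_ge0.
have mc0 : forall A, 0 <= mc A by exact: ba_of_measure_ge0.
apply: le_ereal_EFin => h /(relative_entropy_leP _ nu0 mup.1) H.
apply/relative_entropy_leP => // n A t mA tA AT.
set lhs := \sum_(i < n) _.
suff bound s : lhs <= h + expR s.
  apply/ler_addgt0Pr => e e0; have := bound (ln e).
  by rewrite lnK ?posrE.
pose D := n%:R * `|s + 1| + \sum_(i < n) (`|t i + 1| + expR (t i)).
have D0 : 0 <= D.
  by rewrite addr_ge0 ?mulr_ge0// sumr_ge0// => i _; rewrite addr_ge0 ?expR_ge0.
suff {D0} bound e : 0 < e -> lhs <= h + expR s + e * D.
  apply/ler_addgt0Pr => e e0; have D1 : 0 < D + 1 by rewrite ltr_wpDl.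
  apply: le_trans (bound (e / (D + 1)) _) _; first by rewrite divr_gt0.
  by rewrite lerD2l mulrAC ler_pdivrMr// ler_pM2l// lerDl.
move=> e0.
have /choice[C CP] i := sigma_part_approx mup.1 Q (mA i) e0.
have mC i : measurable (C i) by case: (CP i).
have CA i : C i `<=` A i by case: (CP i).
have mUC : measurable (\big[setU/set0]_(i < n) C i) by exact: bigsetU_measurable.
pose S := ~` \big[setU/set0]_(i < n) C i.
have mS : measurable S by exact: measurableC.
have nuS : nu S <= n%:R * e.
  apply: (@le_trans _ _ (nu (\big[setU/set0]_(i < n) (A i `\` C i)))).
    apply: ba_le => //.
      by apply: bigsetU_measurable => i _; exact: measurableD.
    move=> x Sx; have [i _ Aix] : (\bigcup_i A i) x by rewrite AT.
    rewrite -bigcup_seq; exists i; first by rewrite /= mem_index_enum.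
    by split => // Cix; apply: Sx; rewrite -bigcup_seq; exists i; rewrite //= mem_index_enum.
  apply: le_trans (ba_bigU_le _ nu0 _) _; first by move=> i; exact: measurableD.
  rewrite mulr_natl -[n in leRHS]card_ord -sumr_const.
  by apply: ler_sum => i _; case: (CP i).
have {}H := H n.+1 (fun i => oapp C S (unlift ord0 i))
  (fun i => oapp t s (unlift ord0 i)).
have {H} : nu S * (s + 1) - mu S * expR s +
    \sum_(i < n) (nu (C i) * (t i + 1) - mu (C i) * expR (t i)) <= h.
  have := H _ _ _; rewrite big_ord_recl unlift_none /=.
  under eq_bigr do rewrite liftK/=.
  apply.
  - by move=> i; case: (unlift ord0 i).
  - move=> i j _ _ [x []].
    have SC k : S x -> C k x -> False.
      by move=> Sx Ckx; apply: Sx; rewrite -bigcup_seq; exists k; rewrite //= mem_index_enum.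
    case: unliftP => [i' ->|->] /=; case: unliftP => [j' ->|->]//= ? ?.
    - by rewrite (tA i' j')//; exists x; split; exact: CA.
    - by exfalso; apply: (SC i').
    - by exfalso; apply: (SC j').
  - apply/seteqP; split => // x _.
    have [Sx|/contrapT] := pselect (S x); first by exists ord0; rewrite // unlift_none.
    by rewrite -bigcup_seq => -[i _ Cix]; exists (lift ord0 i); rewrite // liftK.
have muS : mu S * expR s <= expR s by rewrite ger_pMl ?expR_gt0 ?ba_prob_le1.
have nuSs : - (e * (n%:R * `|s + 1|)) <= nu S * (s + 1).
  rewrite lerNl -mulrN (le_trans (ler_norm _))// normrM normrN ger0_norm//.
  by rewrite mulrA (mulrC e) ler_wpM2r.
have sumC : lhs - e * (\sum_(i < n) (`|t i + 1| + expR (t i))) <=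
    \sum_(i < n) (nu (C i) * (t i + 1) - mu (C i) * expR (t i)).
  rewrite /lhs mulr_sumr -sumrB; apply: ler_sum => i _.
  have [_ _ muC nuAC] := CP i.
  have nuA : nu (A i) = nu (C i) + nu (A i `\` C i).
    rewrite -baU ?setDIK//; first by rewrite setDUK.
    exact: measurableD.
  have := ler_wpM2r (expR_ge0 (t i)) muC; rewrite -/mc.
  have : nu (A i `\` C i) * (t i + 1) <= e * `|t i + 1|.
    by rewrite (le_trans (ler_norm _))// normrM ger0_norm// ler_wpM2r.
  by rewrite nuA; lra.
by rewrite /D; lra.
Qed.

End sigma_part_properties.

(** * Existence and equality of the two minima *)

Section minimizers.
Context (d : measure_display) (T : measurableType d) (R : realType).
Variables (P : set (probability T R)) (P0 : P !=set0) (Q : probability T R).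

Let K : set (ba T R) := [set ba_of_measure p | p in P].
Let C := closure (convex_hull K).
Let H := relative_entropy (ba_of_measure Q).

Let Q0 A : 0 <= ba_of_measure Q A. Proof. exact: ba_of_measure_ge0. Qed.

Let C_prob : C `<=` ba_prob.
Proof.
by apply: closure_hull_ba_prob => _ [p _ <-]; exact: ba_of_measure_prob.
Qed.

Let C_neq0 : C !=set0.
Proof.
have KC : K `<=` convex_hull K by exact: sub_smallest.
by have [p Pp] := P0; exists (ba_of_measure p); apply: subset_closure; apply: KC; exists p.
Qed.

(** Lower semicontinuity of the entropy, for cluster points: each inequality of
    the dual formula defines a closed set. *)
Lemma cluster_entropy_le (F : set_system (ba T R)) mu (r : R) : ba_prob mu ->
  F [set rho | ba_prob rho /\ (H rho <= r%:E)%E] -> cluster F mu ->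
  ProperFilter F -> (H mu <= r%:E)%E.
Proof.
move=> mup Fr clmu PF; apply/relative_entropy_leP => //; first exact: mup.1.
move=> n A t mA tA AT.
pose g (rho : ba T R) := \sum_(i < n) expR (t i) * rho (A i).
have gcl : closed [set rho : ba T R |
    \sum_(i < n) ba_of_measure Q (A i) * (t i + 1) - r <= g rho].
  by apply: (closed_comp _ (@closed_ge R _)) => rho _; exact: ba_sum_eval_continuous.
rewrite sumrB lerBlDr -lerBlDl.
under [leRHS]eq_bigr do rewrite mulrC.
apply: (closed_cluster gcl _ clmu); apply: filterS Fr => rho [rho0].
move=> /(relative_entropy_leP _ Q0 rho0.1)/(_ n A t mA tA AT).
rewrite sumrB lerBlDr -lerBlDl => /le_trans; apply.
by rewrite /g; under [leRHS]eq_bigr do rewrite mulrC.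
Qed.

Lemma closure_hull_minimizer : exists2 mu, C mu & forall rho, C rho -> (H mu <= H rho)%E.
Proof.
pose m := ereal_inf [set H mu | mu in C].
have mH rho : C rho -> (m <= H rho)%E by move=> Cr; apply: ereal_inf_lbound; exists rho.
have [moo|mfin] := eqVneq m +oo%E.
  have [mu Cmu] := C_neq0; exists mu => // rho /mH; rewrite moo leye_eq => /eqP ->.
  exact: leey.
pose B (r : R) := [set mu | C mu /\ (H mu <= r%:E)%E].
pose D := [set r : R | (m < r%:E)%E].
have [r0 Dr0] : D !=set0.
  suff [r mr] : exists r : R, (m < r%:E)%E by exists r.
  move: mfin; case: (m) => [r _|//|_]; last by exists 0; rewrite ltNyr.
  by exists (r + 1); rewrite lte_fin ltrDl.
have FF : ProperFilter (filter_from D B).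
  apply: filter_from_proper.
    apply: filter_from_filter => [|r s Dr Ds]; first by exists r0.
    exists (Num.min r s).
      by case: leP => _; [exact: Dr|exact: Ds].
    move=> mu [Cmu]; rewrite EFin_min le_min => /andP[Hr Hs].
    by split; split.
  move=> r /ereal_inf_lt[_ [mu Cmu <-] /ltW Hmu].
  by exists mu.
have FC : filter_from D B C.
  by exists r0 => // mu [].
have [mu [Cmu clmu]] := closure_hull_compact FF FC.
have Hmu r : D r -> (H mu <= r%:E)%E.
  move=> Dr; apply: (cluster_entropy_le (C_prob Cmu) _ clmu FF).
  by exists r => // rho [/C_prob Crho Hr].
exists mu => // rho /mH; apply: le_trans; apply: le_ereal_EFin => h mh.
apply/lee_addgt0Pr => e e0; rewrite -EFinD; apply: Hmu.
by rewrite /D/= (le_lt_trans mh)// lte_fin ltrDl.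
Qed.

Lemma closure_hull_le_effective_null p : effective_null P p ->
  exists2 mu, C mu & (H mu <= H (ba_of_measure p))%E.
Proof.
move=> /(effective_null_dominated P0)[mu Cmu pmu]; exists mu => //.
have mu0 := (C_prob Cmu).1.
apply: le_ereal_EFin => h /(relative_entropy_leP _ Q0 (ba_of_measure_ge0 p)) Hh.
apply/relative_entropy_leP => // n A t mA tA AT.
apply: le_trans (Hh n A t mA tA AT); apply: ler_sum => i _.
by rewrite lerD2l lerN2 ler_wpM2r ?expR_ge0// pmu.
Qed.

Lemma effective_null_le_closure_hull mu : C mu ->
  exists2 p, effective_null P p & (H (ba_of_measure p) <= H mu)%E.
Proof.
move=> Cmu; have mup := C_prob Cmu; exists (sigma_part mup.1).
  exact: sigma_part_effective_null.
exact: sigma_part_entropy.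
Qed.

End minimizers.

Theorem corollary3p6 (d : measure_display) (T : measurableType d) (R : realType)
    (P : set (probability T R)) (hP : P !=set0) (Q : probability T R) :
  exists m : \bar R,
    is_minimum
      [set relative_entropy (ba_of_measure Q) (ba_of_measure p) |
        p in effective_null P] m /\
    is_minimum
      [set relative_entropy (ba_of_measure Q) mu |
        mu in closure (convex_hull [set ba_of_measure p | p in P])] m.
Proof.
have [mu Cmu mu_min] := closure_hull_minimizer hP Q.
have lb p : effective_null P p ->
    (relative_entropy (ba_of_measure Q) mu <=
     relative_entropy (ba_of_measure Q) (ba_of_measure p))%E.
  move=> /(closure_hull_le_effective_null hP Q)[rho Crho].
  exact/le_trans/mu_min.
exists (relative_entropy (ba_of_measure Q) mu); split; split.
- have [p Pp pmu] := effective_null_le_closure_hull Q Cmu.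
  by exists p => //; apply/le_anti; rewrite pmu lb.
- by move=> _ [p Pp <-]; exact: lb.
- by exists mu.
- by move=> _ [rho Crho <-]; exact: mu_min.
Qed.
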